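(* Let $e\in\mathbb{Z}$ with $e\notin\{-1,0,1\}$. Let $\alpha\in\mathrm{S}_n$ be a permutation with $\mathrm{type}(\alpha)=\langle g_1,g_2,\ldots,g_n\rangle$ and $g_1=0$, and let $w=\mathrm{ord}(\alpha)=\operatorname{lcm}\{a\mid 1\leq a\leq n,\ g_a\neq 0\}$ be the order of $\alpha$. Assume that for any choice of integers $r\geq 2$ and $d\geq 2$ with $\gcd(e-1,r)=1$, $r\mid e^{w}-1$, $d\mid w$ and $dr\in F_d(\alpha)$ we have $g_d=0$ and $\gcd(e^{d}-1,r)=1$. If $y\in\mathrm{S}_n$ is a solution of $\alpha\circ y\circ\alpha^{-1}=y^{e}$ such that $\gcd(e-1,s)=1$ for any cycle length $s\geq 2$ of $y$, then $y=1$.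
   Context: $\mathrm{S}_n$ is the symmetric group of all bijections $\{1,2,\ldots,n\}\to\{1,2,\ldots,n\}$ under composition $\circ$, with identity $1$. The type of $\pi\in\mathrm{S}_n$ is the sequence $\mathrm{type}(\pi)=\langle t_1,\ldots,t_n\rangle$, where $t_i\geq 0$ is the number of cycles of $\pi$ of length $i$ (fixed points are cycles of length $1$). For $\alpha\in\mathrm{S}_n$ with $\mathrm{type}(\alpha)=\langle g_1,\ldots,g_n\rangle$ and an integer $1\leq d\leq n$, the $d$-range of $\alpha$ is the set of integers $$F_d(\alpha)=\Big\{\sum_{1\leq j\leq n,\ d\mid j} q_j\cdot j\ \Big|\ 0\leq q_j\leq g_j \text{ for all } 1\leq j\leq n\Big\},$$ where the $q_j$ are integers. *)

(* Defs.v *)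
From mathcomp Require Import all_boot all_order all_algebra all_fingroup.

Set Implicit Arguments.
Unset Strict Implicit.
Unset Printing Implicit Defensive.

Import GRing.Theory Num.Theory.

(* The entry t_i of type(pi) = <t_1, ..., t_n>; [porbits pi] contains the
   singletons of fixed points, and the entry is 0 for i = 0 and for i > n. *)
Definition cycle_type (n : nat) (pi : 'S_n) (i : nat) : nat :=
  #|[set c in porbits pi | #|c| == i]|.

(* The set {1, ..., n} is modelled by 'I_n. Since 0 <= q_j <= t_j, the integers
   q_j are natural numbers, and so are the elements of the d-range. *)
Definition d_range (n : nat) (pi : 'S_n) (d m : nat) : Prop :=
  exists2 q : nat -> nat,
    forall j : nat, 1 <= j <= n -> q j <= cycle_type pi j
  & m = \sum_(1 <= j < n.+1 | d %| j) q j * j.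

(* The group law of 'S_n applies its left factor first, so composition of
   functions is the opposite product. *)
Definition perm_comp (n : nat) (s t : 'S_n) : 'S_n := (t * s)%g.

Lemma perm_compE (n : nat) (s t : 'S_n) : perm_comp s t =1 s \o t.
Proof. by move=> x; rewrite permM. Qed.

(* [Negz k] is the integer - (k + 1). *)
Definition perm_expz (n : nat) (s : 'S_n) (e : int) : 'S_n :=
  match e with
  | Posz k => (s ^+ k)%g
  | Negz k => (s ^- k.+1)%g
  end.

(* Main.v *)
Require Import Defs.
From mathcomp Require Import all_boot all_order all_algebra all_fingroup.
From mathcomp Require Import cyclic ring.
Import GRing.Theory Num.Theory.

(** Since alpha conjugates y to a power of y, it permutes the cycles of y.
    Suppose that y has a cycle C of length r >= 2, and let d be the size of the
    alpha-orbit of C. The union U of this orbit has d * r points and is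
    alpha-stable, and every cycle of alpha in U has length divisible by d, so
    that d * r lies in the d-range of alpha. Moreover alpha^w = 1 gives
    y = y^(e^w), so that r divides e^w - 1. If C is identified with Z/r so that y
    becomes j |-> j + 1, then alpha^d becomes an affine map of slope e^d. As
    e^d - 1 is prime to r (by the hypothesis on the cycle lengths of y if d = 1,
    by the one on alpha otherwise), alpha^d
    has a fixed point in C; it lies on an alpha-cycle of length exactly d,
    contradicting g_d = 0. *)

Lemma porbit_expg_eq (T : finType) (s : {perm T}) (x : T) (k l : nat) :
  ((s ^+ k)%g x == (s ^+ l)%g x) = (k == l %[mod #|porbit s x|]).
Proof.
have r_gt0 : 0 < #|porbit s x| by rewrite lt0n card_porbit_neq0.
have modE j : (s ^+ j)%g x = (s ^+ (j %% #|porbit s x|))%g x.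
  rewrite {1}(divn_eq j #|porbit s x|) addnC expgD permM.
  set z := (s ^+ _)%g x.
  have zr : (s ^+ #|porbit s x|)%g z = z.
    by rewrite permX -(porbit_perm s (j %% #|porbit s x|) x) iter_porbit.
  rewrite mulnC expgM; elim: (j %/ _) => [|i IHi]; first by rewrite expg0 perm1.
  by rewrite expgS permM zr.
have nthE j : nth x (traject s x #|porbit s x|) (j %% #|porbit s x|)
              = (s ^+ j)%g x.
  by rewrite (nth_traject _ (ltn_pmod _ _)) // -permX -modE.
rewrite -!nthE nth_uniq ?size_traject ?ltn_pmod //.
exact: uniq_traject_porbit.
Qed.

Lemma porbit_expg_fix (T : finType) (s : {perm T}) (x : T) (k : nat) :
  ((s ^+ k)%g x == x) = (#|porbit s x| %| k).
Proof.
by have := porbit_expg_eq T s x k 0; rewrite expg0 perm1 mod0n.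
Qed.

Lemma card_porbit_dvd_order (T : finType) (s : {perm T}) (x : T) :
  #|porbit s x| %| #[s]%g.
Proof. by rewrite -porbit_expg_fix expg_order perm1. Qed.

Lemma PoszX (m k : nat) : ((m ^ k)%N%:Z = m%:Z ^+ k)%R.
Proof. exact: (rmorphXn Posz). Qed.

Lemma conjg_expg_iter (gT : finGroupType) (a y : gT) (m k : nat) :
  (y ^ a = y ^+ m -> y ^ (a ^+ k) = y ^+ (m ^ k))%g.
Proof.
move=> ya; elim: k => [|k IHk]; first by rewrite expg0 conjg1 expn0 expg1.
by rewrite expgSr conjgM IHk conjXg ya -expgM expnS.
Qed.

(** Conjugate elements have the same order, so [y ^+ m] generates the same cyclic group as [y] and
    has the same cycles; no coprimality of [m] has to be assumed. *)
Lemma porbit_normalized (T : finType) (a y : {perm T}) (m : nat) (x : T) :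
  (y ^ a = y ^+ m)%g -> porbit y (a x) = a @: porbit y x.
Proof.
move=> ya.
have yma : <[y ^+ m]>%g = <[y]>%g.
  by apply/eqP; rewrite eqEcard cycleX -ya -!orderE orderJ leqnn.
have -> : porbit y (a x) = porbit (y ^ a)%g (a x).
  by rewrite !porbitE /= ya yma.
apply/setP=> z.
apply/porbitP/imsetP => [[i ->]|[_ /porbitP[i ->] ->]].
- by exists ((y ^+ i)%g x); rewrite ?mem_porbit // -conjXg permJ.
- by exists i; rewrite -conjXg permJ.
Qed.

(** [actperm 'P^* a] is the permutation of subsets induced by [a], so that the orbit of a cycle
    under [a] is itself a [porbit]. *)
Lemma actperm_setactX (T : finType) (a : {perm T}) (k : nat) (S : {set T}) :
  ((actperm 'P^* a ^+ k)%g S = (a ^+ k)%g @: S).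
Proof.
rewrite -(morphX (actperm_morphism 'P^*)) ?inE //= actpermE.
by rewrite /= /setact.
Qed.

Lemma affine_fixed_point (M b r : nat) :
  0 < r -> coprimez (M%:Z - 1)%R r%:Z -> exists j, b + M * j = j %[mod r].
Proof.
move=> r_gt0 /coprimezP[[u v] /= uv].
have r_neq0 : (r%:Z != 0)%R by rewrite -lt0n.
have jE := gez0_abs (modz_ge0 (- b%:Z * u)%R r_neq0).
(* A fixed point solves [(M - 1) * j = - b] modulo [r], and [u] is an inverse of [M - 1]. *)
exists `|(- b%:Z * u %% r)%Z|%N.
apply/eqP; rewrite -eqz_nat -!modz_nat PoszD PoszM jE.
rewrite -modzDmr modzMmr modzDmr modz_mod eqz_mod_dvd.
suff -> : (b%:Z + M%:Z * (- b%:Z * u) - (- b%:Z * u) = b%:Z * v * r%:Z)%R.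
  exact: dvdz_mull.
have -> : (b%:Z * v * r%:Z = b%:Z * (v * r%:Z))%R by ring.
have -> : (v * r%:Z = 1 - u * (M%:Z - 1))%R by rewrite -{1}uv; ring.
by ring.
Qed.

(* Indexing the y-cycle of x by j |-> y^j x turns a into the affine map
   j |-> b + M j, where a x = y^b x. *)
Lemma porbit_fixed_point (T : finType) (a y : {perm T}) (M : nat) (x : T) :
    (y ^ a = y ^+ M)%g -> a x \in porbit y x ->
    coprimez (M%:Z - 1)%R #|porbit y x| ->
  exists2 z, z \in porbit y x & a z = z.
Proof.
move=> ya /porbitP[b axE] cop.
have r_gt0 : 0 < #|porbit y x| by rewrite lt0n card_porbit_neq0.
have [j /eqP jP] := affine_fixed_point M b _ r_gt0 cop.
exists ((y ^+ j)%g x); first exact: mem_porbit.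
rewrite -permJ conjXg ya -expgM axE -permM -expgD.
by apply/eqP; rewrite porbit_expg_eq.
Qed.

Lemma perm_expz_mod (n : nat) (s : 'S_n) (e : int) (m : nat) :
  (m%:Z = e %[mod #[s]%g])%Z -> perm_expz s e = (s ^+ m)%g.
Proof.
case: e => k /eqP; rewrite eqz_mod_dvd.
  rewrite -eqz_mod_dvd !modz_nat => /eqP[mk].
  by rewrite /= -expg_mod_order -mk expg_mod_order.
rewrite NegzE opprK => dvd; apply/eqP.
by rewrite /= eq_mulVg1 invgK -expgD addnC -order_dvdn.
Qed.

Lemma porbits_partition (T : finType) (s : {perm T}) :
  partition (porbits s) [set: T].
Proof.
have -> : porbits s = [set orbit 'P <[s]>%g x | x in [set: T]].
  by apply/setP=> c; apply/imsetP/imsetP=> -[x _ ->]; exists x;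
    rewrite ?inE ?porbitE.
by apply: orbit_partition; apply/actsP=> a _ x; rewrite !inE.
Qed.

Lemma porbits_card_gt0 (T : finType) (s : {perm T}) (c : {set T}) :
  c \in porbits s -> 0 < #|c|.
Proof. by case/imsetP=> x _ ->; rewrite lt0n card_porbit_neq0. Qed.

(** With [q j] the number of cycles of length [j] in [P], the sum counts the points of the disjoint
    union by cycle length. *)
Lemma d_range_porbits (n : nat) (s : 'S_n) (d : nat) (P : {set {set 'I_n}}) :
    P \subset porbits s -> {in P, forall c : {set 'I_n}, d %| #|c|} ->
  d_range s d #|cover P|.
Proof.
move=> sP dP; exists (fun j => #|[set c in P | #|c| == j]|) => [j _|].
  apply/subset_leq_card/subsetP=> c; rewrite !inE => /andP[/(subsetP sP)-> ->].
  by [].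
have /and3P[_ tI _] := porbits_partition _ s.
have /eqP <- := trivIsetS sP tI.
pose f (c : {set 'I_n}) : 'I_n.+1 := inord #|c|.
have fE (c : {set 'I_n}) : f c = #|c| :> nat.
  by rewrite inordK // ltnS -[n in _ <= n]card_ord max_card.
rewrite big_geq_mkord /=.
(* The condition [0 < j] matches the lower bound 1 in [d_range]; it holds because cycles are
   nonempty. *)
rewrite (partition_big f (fun j => (d %| j) && (0 < j))) => [|c cP]; last first.
  by rewrite fE dP //= (porbits_card_gt0 _ s) // (subsetP sP).
apply: eq_bigr => j _; rewrite (eq_bigr (fun=> j : nat)) => [|c /andP[_ /eqP <-]].
  by rewrite sum_nat_const; congr (_ * _);
    apply: eq_card => c; rewrite inE -fE val_eqE.
by rewrite fE.
Qed.

Theorem theorem2p12 (n : nat) (e : int)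
  (e_neqN1 : e <> (-1)%R) (e_neq0 : e <> 0%R) (e_neq1 : e <> 1%R)
  (alpha : 'S_n) (g1_eq0 : cycle_type alpha 1 = 0)
  (Halpha : forall r d : nat, 2 <= r -> 2 <= d ->
     coprimez (e - 1)%R r%:Z ->
     (r%:Z %| (e ^+ #[alpha]%g - 1)%R)%Z ->
     d %| #[alpha]%g ->
     d_range alpha d (d * r) ->
     cycle_type alpha d = 0 /\ coprimez (e ^+ d - 1)%R r%:Z)
  (y : 'S_n)
  (y_sol : perm_comp (perm_comp alpha y) (alpha^-1)%g = perm_expz y e)
  (y_cycles : forall s : nat, 2 <= s -> cycle_type y s <> 0 ->
     coprimez (e - 1)%R s%:Z) :
  y = 1%g.
Proof.
(* A natural exponent m congruent to e avoids integer powers in 'S_n. *)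
pose m := `|(e %% #[y]%g)%Z|%N.
have mE : (m%:Z = e %[mod #[y]%g])%Z.
  by rewrite gez0_abs ?modz_mod // modz_ge0 // -lt0n order_gt0.
have ya : (y ^ alpha = y ^+ m)%g by rewrite -(perm_expz_mod _ _ _ _ mE) -y_sol.
apply/permP=> x; rewrite perm1; apply/eqP/negPn/negP=> yx.
set r := #|porbit y x|.
have r_gt1 : 1 < r.
  rewrite ltn_neqAle lt0n card_porbit_neq0 andbT eq_sym.
  by apply: contra yx => /eqP r1; rewrite -[y]expg1 porbit_expg_fix -/r r1.
have mXE k : (m%:Z ^+ k = e ^+ k %[mod r])%Z.
  have mr : (m%:Z = e %[mod r])%Z.
    apply/eqP; rewrite eqz_mod_dvd; apply: (@dvdz_trans #[y]%g).
      exact: card_porbit_dvd_order.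
    by rewrite -eqz_mod_dvd mE.
  by rewrite -modzXm mr modzXm.
have cop_e : coprimez (e - 1)%R r.
  apply: y_cycles => // /eqP; apply/negP; rewrite -lt0n card_gt0.
  by apply/set0Pn; exists (porbit y x); rewrite inE imset_f /=.
pose b := actperm 'P^* alpha.
pose P := porbit b (porbit y x).
pose d := #|P|.
have bE k z : (b ^+ k)%g (porbit y z) = porbit y ((alpha ^+ k)%g z).
  rewrite actperm_setactX.
  by rewrite -(porbit_normalized _ _ _ _ _ (conjg_expg_iter _ _ _ _ k ya)).
have d_gt0 : 0 < d by rewrite lt0n card_porbit_neq0.
(* If [alpha ^+ k] fixes [z], then [b ^+ k] fixes the [y]-cycle of [z]. This cycle lies in the orbit
   [P], of size [d]. *)
have in_block z k : z \in cover P -> (alpha ^+ k)%g z = z -> d %| k.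
  case/bigcupP=> c /porbitP[i ->]; rewrite bE -eq_porbit_mem => /eqP zP fix_z.
  have := mem_porbit b i (porbit y x); rewrite -eq_porbit_mem => /eqP bP.
  by rewrite /d /P -bP bE -zP -porbit_expg_fix bE fix_z.
have C_sub : porbit y x \subset cover P by apply: bigcup_sup; apply: porbit_id.
have cop_fix : coprimez (e ^+ d - 1)%R r -> cycle_type alpha d <> 0.
  move=> cop.
  have [|||z zC fix_z] := porbit_fixed_point _ (alpha ^+ d)%g y (m ^ d) x.
  - exact: conjg_expg_iter.
  - by rewrite -eq_porbit_mem -bE porbit_expg_fix.
  (* The slope is [m ^ d], congruent to [e ^+ d] modulo [r]. *)
  - rewrite /coprimez -gcdz_modl PoszX.
    by rewrite -modzDml mXE modzDml gcdz_modl.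
  apply/eqP; rewrite -lt0n card_gt0; apply/set0Pn; exists (porbit alpha z).
  rewrite inE imset_f //= eqn_dvd -porbit_expg_fix fix_z eqxx.
  apply: (in_block z); first exact: (subsetP C_sub).
  by apply/eqP; rewrite porbit_expg_fix.
(* For [d = 1] the fixed point of [alpha] contradicts [g1_eq0]. *)
have [d_le1|d_gt1] := leqP d 1.
  have d1 : d = 1 by apply/eqP; rewrite eqn_leq d_le1.
  by move: cop_fix; rewrite d1 expr1 => /(_ cop_e).
have P_sub : P \subset porbits y.
  by apply/subsetP=> c /porbitP[k ->]; rewrite bE imset_f.
have card_cover : #|cover P| = d * r.
  have /and3P[_ tI _] := porbits_partition _ y.
  have /eqP <- := trivIsetS P_sub tI.
  rewrite -sum_nat_const; apply: eq_bigr => c /porbitP[k ->].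
  by rewrite actperm_setactX card_imset //; apply: perm_inj.
have alpha_cover z k : z \in cover P -> (alpha ^+ k)%g z \in cover P.
  case/bigcupP=> c cP zc; apply/bigcupP; exists ((b ^+ k)%g c).
    by rewrite -eq_porbit_mem porbit_perm eq_porbit_mem.
  by rewrite actperm_setactX imset_f.
(* The union of [P] was counted above by [y]-cycles; cutting it into [alpha]-cycles puts the same
   number [d * r] in the [d]-range. *)
pose Q := [set c in porbits alpha | c \subset cover P].
have coverQ : cover Q = cover P.
  apply/eqP; rewrite eqEsubset; apply/andP; split.
    by apply/bigcupsP=> c; rewrite inE => /andP[].
  apply/subsetP=> z zP; apply/bigcupP; exists (porbit alpha z).
    rewrite inE imset_f //=; apply/subsetP=> _ /porbitP[k ->].
    exact: alpha_cover.
  exact: porbit_id.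
have [] // := Halpha r d; last by move=> g0 /cop_fix.
(* Conjugating by [alpha ^+ #[alpha] = 1] gives [y ^+ (m ^ #[alpha]) = y]; evaluation at [x] yields
   the congruence modulo [r]. *)
- rewrite -eqz_mod_dvd -mXE -PoszX -[1%R]/(Posz 1) !modz_nat eqz_nat.
  rewrite -(porbit_expg_eq _ y x) -(conjg_expg_iter _ _ _ _ #[alpha]%g ya).
  by rewrite expg_order conjg1 expg1.
- by apply: (in_block x); rewrite ?expg_order ?perm1 // (subsetP C_sub) ?porbit_id.
- rewrite -card_cover -coverQ; apply: d_range_porbits.
    by apply/subsetP=> c; rewrite inE => /andP[].
  move=> _ /setIdP[/imsetP[z _ ->] /subsetP zP].
  apply: (in_block z); first by rewrite zP ?porbit_id.
  by apply/eqP; rewrite porbit_expg_fix.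
Qed.
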